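(* Let $(M,d)$ be a compact metric space, $f\colon M\to M$ a homeomorphism and $0<\varepsilon\le\alpha$. If $f$ is $[\varepsilon,\alpha]$-expansive then $f$ is uniformly $[\varepsilon,\alpha]$-expansive.
   Context: For $0<\varepsilon\le\alpha$, $f$ is $[\varepsilon,\alpha]$-expansive if: $x,y\in M$ and $d(f^nx,f^ny)\le\alpha$ for all $n\in\mathbb Z$ implies $d(x,y)<\varepsilon$. $f$ is uniformly $[\varepsilon,\alpha]$-expansive if for some $N\in\mathbb N$: $x,y\in M$ and $d(f^nx,f^ny)\le\alpha$ for all $|n|\le N$ implies $d(x,y)<\varepsilon$. *)

(* Defs.v *)
From HB Require Import structures.
From mathcomp Require Import all_boot all_order all_algebra.
From mathcomp Require Import all_classical all_reals all_analysis.

Set Implicit Arguments.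
Unset Strict Implicit.
Unset Printing Implicit Defensive.

Import Order.TTheory GRing.Theory Num.Theory.

Local Open Scope classical_set_scope.
Local Open Scope ring_scope.

(* [{splitbij [set: T] >-> [set: U]}] is the type of bijections T -> U
   packaged with their two-sided inverse, written [f^-1%FUN]. *)
Definition homeomorphism (T U : topologicalType)
    (f : {splitbij [set: T] >-> [set: U]}) : Prop :=
  continuous f /\ continuous f^-1%FUN.

(* Recall that [Negz k] is the integer -(k + 1). *)
Definition iterz (T : Type) (f : {splitbij [set: T] >-> [set: T]}) (n : int) :
    T -> T :=
  match n with
  | Posz k => iter k f
  | Negz k => iter k.+1 f^-1%FUN
  end.

Definition expansive (R : realType) (M : metricType R) (e a : R)
    (f : {splitbij [set: M] >-> [set: M]}) : Prop :=
  forall x y : M,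
    (forall n : int, mdist (iterz f n x) (iterz f n y) <= a) ->
    mdist x y < e.

Definition uniformly_expansive (R : realType) (M : metricType R) (e a : R)
    (f : {splitbij [set: M] >-> [set: M]}) : Prop :=
  exists N : nat, forall x y : M,
    (forall n : int, (`|n| <= N)%N ->
      mdist (iterz f n x) (iterz f n y) <= a) ->
    mdist x y < e.

(* Main.v *)
(** If uniformity fails, for each N there is a pair at distance >= e whose
    iterates stay within a for all |n| <= N.  These pairs cluster in the compact
    space M * M, and since all the conditions involved are closed, the cluster
    point contradicts expansiveness. *)
Require Import Defs.
From HB Require Import structures.
From mathcomp Require Import all_boot all_order all_algebra.
From mathcomp Require Import all_classical all_reals all_analysis.
From mathcomp Require Import lra.

Import Order.TTheory GRing.Theory Num.Theory.
Import numFieldNormedType.Exports.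

Local Open Scope classical_set_scope.
Local Open Scope ring_scope.

(** Two triangle inequalities in each direction bound the change of the distance by
    [mdist x u + mdist y v], so radius [e / 2] in each factor suffices. *)
Lemma mdist_continuous (R : realType) (M : metricType R) :
  continuous (fun p : M * M => mdist p.1 p.2).
Proof.
move=> [x y]; apply/cvgrPdist_lt => e e_gt0.
have e2_gt0 : 0 < e / 2 by rewrite divr_gt0.
exists (ball x (e / 2), ball y (e / 2)) => [|[u v] /= []].
  by split; exact: nbhsx_ballx.
rewrite !ballEmdist /= => xu yv.
have xy_le := metric_triangle x u y; have uy_le := metric_triangle u v y.
have uv_le := metric_triangle u x v; have xv_le := metric_triangle x y v.
rewrite (metric_sym v y) in uy_le; rewrite (metric_sym u x) in uv_le.
by rewrite ltr_norml; apply/andP; split; lra.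
Qed.

Lemma iter_continuous (T : topologicalType) (g : T -> T) (k : nat) :
  continuous g -> continuous (iter k g).
Proof.
move=> g_cont; elim: k => [|k IHk] x; first exact: cvg_id.
exact: (continuous_comp (IHk x) (g_cont _)).
Qed.

Lemma iterz_continuous (T : topologicalType)
    (f : {splitbij [set: T] >-> [set: T]}) (n : int) :
  homeomorphism f -> continuous (iterz f n).
Proof. by case=> f_cont finv_cont; case: n => k; exact: iter_continuous. Qed.

(** This makes each condition on the [n]-th iterates a closed condition on pairs; for negative [n]
    it rests on the continuity of the inverse. *)
Lemma iterz_mdist_continuous (R : realType) (M : metricType R)
    (f : {splitbij [set: M] >-> [set: M]}) (n : int) :
  homeomorphism f ->
  continuous (fun p : M * M => mdist (iterz f n p.1) (iterz f n p.2)).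
Proof.
move=> f_homeo p.
apply: (@continuous_comp _ _ _ (fun p : M * M => (iterz f n p.1, iterz f n p.2))
  (fun p : M * M => mdist p.1 p.2)); last exact: mdist_continuous.
apply: cvg_pair; apply: continuous_comp; try exact: iterz_continuous.
  exact: cvg_fst.
exact: cvg_snd.
Qed.

Theorem proposition2p5 (R : realType) (M : metricType R)
    (M_compact : compact [set: M])
    (f : {splitbij [set: M] >-> [set: M]}) (f_homeo : homeomorphism f)
    (e a : R) (e_gt0 : 0 < e) (e_le_a : e <= a) :
  expansive e a f -> uniformly_expansive e a f.
Proof.
move=> f_exp; apply: contrapT => not_unif.
have /choice[u u_bad] (N : nat) : exists p : M * M,
    (forall n : int, (`|n| <= N)%N ->
      mdist (iterz f n p.1) (iterz f n p.2) <= a) /\ e <= mdist p.1 p.2.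
  apply: contrapT => no_bad; apply: not_unif; exists N => x y xy_close.
  by rewrite ltNge; apply/negP => e_le; apply: no_bad; exists (x, y).
have MM_compact : compact [set: M * M].
  by rewrite -setXTT; exact: compact_setX.
have [|p [_ p_cluster]] := MM_compact (u @ \oo) _; first exact: filterT.
(* Every neighbourhood of the cluster point [p] meets a set containing a tail of [u], so [p] lies in
   the closure of that set. No convergent subsequence has to be extracted. *)
have p_in (C : set (M * M)) : closed C -> (\forall N \near \oo, C (u N)) -> C p.
  by move=> C_closed uC; apply: C_closed => B; exact: p_cluster.
have : mdist p.1 p.2 < e.
  apply: f_exp => n.
  apply: (p_in [set q | mdist (iterz f n q.1) (iterz f n q.2) <= a]).
    apply: (@preimage_closed _ _ _ [set r | r <= a]); last exact: closed_le.
    by move=> q _; exact: iterz_mdist_continuous.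
  (* For fixed [n], the pair [u N] satisfies the bound as soon as [N] is at least the absolute value
     of [n]. *)
  by exists `|n|%N => // N /= nN; have [+ _] := u_bad N; exact.
(* The separation by at least [e] holds for every [u N], hence passes to [p]. *)
apply/negP; rewrite -leNgt; apply: (p_in [set q | e <= mdist q.1 q.2]).
  apply: (@preimage_closed _ _ _ [set r | e <= r]); last exact: closed_ge.
  by move=> q _; exact: mdist_continuous.
by exists 0%N => // N _; have [] := u_bad N.
Qed.
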